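(* In any finite graph $G$ with at least one vertex, there is a vertex $v$ whose closed neighborhood meets at most $\binom{d(v)+1}{3}$ triangles, i.e. $$|T_{N[v]}| \le \binom{d(v)+1}{3}.$$
   Context: Graphs are simple and undirected (no loops, no multiple edges). For a graph with edge set $E$ and a vertex $v$, $d(v)$ denotes the degree of $v$, and the closed neighborhood of $v$ is $N[v] := \{u : uv \in E\} \cup \{v\}$. A triangle is an (unordered) set of three pairwise adjacent vertices. $|T_{N[v]}|$ denotes the number of triangles of $G$ having at least one vertex in $N[v]$. The binomial coefficient $\binom{m}{3}$ is $0$ for integers $0 \le m \le 2$. *)

(* Defs.v *)
From mathcomp Require Import all_boot.

Set Implicit Arguments.
Unset Strict Implicit.
Unset Printing Implicit Defensive.

(* A finite simple graph is a finType T of vertices with an adjacency relation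
   e : rel T; theorems assume symmetric e and irreflexive e explicitly. *)
Section Graph.
Variables (T : finType) (e : rel T).

Definition open_nbhd (v : T) : {set T} := [set u | e v u].

Definition degree (v : T) : nat := #|open_nbhd v|.

Definition closed_nbhd (v : T) : {set T} := v |: open_nbhd v.

Definition is_triangle (S : {set T}) : bool :=
  (#|S| == 3) && [forall x in S, forall y in S, (x != y) ==> e x y].

Definition triangles_meeting (A : {set T}) : {set {set T}} :=
  [set S | is_triangle S & S :&: A != set0].

End Graph.

(* Main.v *)
Require Import Defs.
From mathcomp Require Import all_boot.

(** The inequality holds on average: summed over all vertices [v], the left
    sides are at most the right sides, so some vertex satisfies it.

    By Pascal's rule ['C(d + 1, 3) = 'C(d, 2) + 'C(d, 3)].  The triangles that
    contain [v] are paid for by ['C(d, 2)], since such a triangle is determined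
    by its other two vertices, which are neighbours of [v]
    ([card_triangles_through]); this part holds vertex by vertex.

    The triangles that avoid [v] but contain a neighbour of [v] are paid for by
    ['C(d, 3)], but only after summation.  Both totals count pairs consisting of
    a vertex and a 3-set that avoids it, so both can be sorted by the 4-set [Q]
    formed by the pair ([sum_card_pointed]).  It remains to compare, inside one
    [Q], the vertices opposite to a triangle and joined to it, with the vertices
    adjacent to the rest of [Q] ([card_opposite_le_dominating]).  If [Q] spans a
    triangle with one pendant edge these numbers are 1 and 1, for [K_4] minus an
    edge they are 2 and 2, for [K_4] they are 4 and 4, and on every other graph
    the first number is 0. *)

(** Adding [v] to [A] loses nothing as long as [v] stays marked, so a pair
    [(v, A)] with [v] outside [A] amounts to a set with a marked element. *)
Lemma sum_card_pointed (T : finType) (k : nat) (P : T -> {set T} -> bool) :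
  \sum_v #|[set A : {set T} | (#|A| == k) && (v \notin A) & P v A]| =
  \sum_(Q : {set T} | #|Q| == k.+1) #|[set v in Q | P v (Q :\ v)]|.
Proof.
under [RHS]eq_bigr do rewrite -sum1dep_card.
rewrite (exchange_big_dep xpredT) //=; apply: eq_bigr => v _.
rewrite -sum1_card (reindex_onto (fun Q => Q :\ v) (fun A => v |: A)) /=.
  apply: eq_bigl => Q; rewrite !inE eqxx /= andbT.
  have [vQ | vQ] := boolP (v \in Q).
    by rewrite (cardsD1 v Q) vQ setD1K // eqxx !andbT.
  rewrite !andbF; apply/negP => /andP[_ /eqP QE].
  by rewrite -QE setU11 in vQ.
by move=> A; rewrite inE => /andP[/andP[_ vA] _]; rewrite setU1K.
Qed.

Section Graph.
Variables (T : finType) (e : rel T).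
Hypotheses (e_sym : symmetric e) (e_irrefl : irreflexive e).

Lemma triangle_adj {S : {set T}} {a b : T} :
  is_triangle e S -> a \in S -> b \in S -> a != b -> e a b.
Proof.
by case/andP=> _ /forall_inP S_adj /S_adj/forall_inP aS /aS/implyP; apply.
Qed.

Lemma card_triangles_through (v : T) :
  #|[set S | is_triangle e S & v \in S]| <= 'C(degree e v, 2).
Proof.
rewrite /degree -cards_draws.
have del_inj : {in [set S | is_triangle e S & v \in S] &,
    injective (fun S : {set T} => S :\ v)}.
  move=> S1 S2; rewrite !inE => /andP[_ vS1] /andP[_ vS2] eqS.
  by rewrite -(setD1K vS1) eqS setD1K.
rewrite -(card_in_imset del_inj); apply/subset_leq_card/subsetP => S' /imsetP[S].
rewrite inE => /andP[triS vS] ->; rewrite inE; apply/andP; split.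
  apply/subsetP => u; rewrite !inE => /andP[u_v uS].
  by rewrite (triangle_adj triS) // eq_sym.
by case/andP: triS => /eqP; rewrite (cardsD1 v) vS => -[/eqP].
Qed.

(** If every vertex of [Q] is adjacent to the other three, the right side is 4.
    Otherwise take non-adjacent [x] and [y] in [Q]: no triangle contains both, so
    only [x] and [y] can be opposite to one.  If both are, the two triangles
    together cover every pair in [Q] except [xy], so each of the two remaining
    vertices is adjacent to the rest of [Q].  If only one is, any neighbour of it in
    the opposite triangle is adjacent to the rest of [Q]. *)
Lemma card_opposite_le_dominating (Q : {set T}) : #|Q| = 4 ->
  #|[set v in Q | Q :\ v \in triangles_meeting e (closed_nbhd e v)]| <=
  #|[set c in Q | Q :\ c \subset open_nbhd e c]|.
Proof.
move=> Q4; set L := [set v in Q | _]; set R := [set c in Q | _].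
have adjL v a b : v \in L -> a \in Q -> b \in Q ->
    a != v -> b != v -> a != b -> e a b.
  rewrite !inE => /and3P[_ tri _] aQ bQ av bv ab.
  by apply: (triangle_adj tri) => //; rewrite !inE ?av ?bv.
have domR c : c \in Q -> (forall b, b \in Q -> b != c -> e c b) -> c \in R.
  move=> cQ c_adj; rewrite inE cQ; apply/subsetP => b.
  by rewrite !inE => /andP[bc bQ]; apply: c_adj.
have [-> | [v vL]] := set_0Vmem L; first by rewrite cards0.
have R_gt0 : 0 < #|R|.
  have := vL; rewrite !inE => /and3P[vQ _ /set0Pn[c]].
  rewrite !inE => /andP[/andP[cv cQ]]; rewrite (negPf cv) /= => vc.
  apply/card_gt0P; exists c; apply: domR => // b bQ bc.
  have [-> | bv] := eqVneq b v; first by rewrite e_sym.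
  by apply: (adjL v) => //; rewrite eq_sym.
have [QR | ] := boolP (Q \subset R).
  by apply/subset_leq_card/(subset_trans _ QR)/subsetP => w; rewrite inE => /andP[].
case/subsetPn => x xQ; rewrite inE xQ /= => /subsetPn[y].
rewrite !inE => /andP[yx yQ] xy.
have sLxy : L \subset [set x; y].
  apply/subsetP => w wL; rewrite !inE; apply: contraR xy.
  by case/norP => wx wy; apply: (adjL w); rewrite // eq_sym.
have [/andP[xL yL] | not_both] := boolP ((x \in L) && (y \in L)).
  have xy2 : #|[set x; y]| = 2 by rewrite cards2 eq_sym yx.
  apply: leq_trans (subset_leq_card sLxy) _; rewrite xy2.
  have <- : #|Q :\: [set x; y]| = 2.
    by rewrite cardsDS ?Q4 ?xy2 // subUset !sub1set xQ yQ.
  apply/subset_leq_card/subsetP => a; rewrite !inE negb_or.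
  move=> /andP[/andP[ax ay] aQ].
  suff : a \in R by rewrite inE.
  apply: domR => // b bQ ba; have [bx | bx] := eqVneq b x.
    by apply: (adjL y); rewrite // 1?eq_sym // bx.
  by apply: (adjL x); rewrite // eq_sym.
apply: leq_trans R_gt0.
have : L \proper [set x; y].
  rewrite properE sLxy; apply: contra not_both.
  by rewrite subUset !sub1set.
by move/proper_card; rewrite cards2 eq_sym yx.
Qed.

Lemma sum_triangles_avoiding :
  \sum_v #|[set S in triangles_meeting e (closed_nbhd e v) | v \notin S]| <=
  \sum_v 'C(degree e v, 3).
Proof.
pose meets v S := S \in triangles_meeting e (closed_nbhd e v).
pose nbrs v (S : {set T}) := S \subset open_nbhd e v.
have -> : \sum_v #|[set S in triangles_meeting e (closed_nbhd e v) | v \notin S]|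
    = \sum_v #|[set S : {set T} | (#|S| == 3) && (v \notin S) & meets v S]|.
  apply: eq_bigr => v _; apply: eq_card => S; rewrite !inE /meets !inE /is_triangle.
  by case: (#|S| == 3); rewrite /= ?andbF // andbC.
have -> : \sum_v 'C(degree e v, 3)
    = \sum_v #|[set S : {set T} | (#|S| == 3) && (v \notin S) & nbrs v S]|.
  apply: eq_bigr => v _; rewrite /degree -cards_draws.
  apply: eq_card => S; rewrite !inE /nbrs andbC -andbA; congr (_ && _).
  have [/subsetP sSv | ] := boolP (S \subset _); rewrite ?andbF ?andbT //.
  by apply/esym/negP => /sSv; rewrite inE e_irrefl.
rewrite !sum_card_pointed; apply: leq_sum => Q /eqP.
exact: card_opposite_le_dominating.
Qed.

Lemma sum_triangles_meeting :
  \sum_v #|triangles_meeting e (closed_nbhd e v)| <=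
  \sum_v 'C((degree e v).+1, 3).
Proof.
under [leqRHS]eq_bigr => v _ do rewrite binS addnC.
rewrite [leqRHS]big_split /=.
have through : \sum_v #|[set S | is_triangle e S & v \in S]| <=
    \sum_v 'C(degree e v, 2).
  by apply: leq_sum => v _; apply: card_triangles_through.
apply: leq_trans (leq_add through sum_triangles_avoiding).
rewrite -big_split /=; apply: leq_sum => v _.
rewrite -(cardsID [set S : {set T} | v \in S]) leq_add //;
  apply/subset_leq_card/subsetP => S; rewrite !inE.
  by case/andP=> /andP[-> _].
by case/andP=> -> ->.
Qed.

End Graph.

Theorem lemma1 (T : finType) (e : rel T)
    (e_sym : symmetric e) (e_irrefl : irreflexive e) (T_gt0 : 0 < #|T|) :
  exists v : T,
    #|triangles_meeting e (closed_nbhd e v)| <= 'C((degree e v).+1, 3).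
Proof.
apply/existsP; apply: contraLR (sum_triangles_meeting _ _ e_sym e_irrefl).
rewrite negb_exists -ltnNge => /forallP all_gt.
have [v0 _] := card_gt0P T_gt0.
rewrite (bigD1 v0) //= [ltnRHS](bigD1 v0) //= -addSn.
by apply: leq_add; [|apply: leq_sum => v _; apply: ltnW]; rewrite ltnNge.
Qed.
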